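(* Suppose that $e\ge2$ and $f\ge2$, i.e. the extension $F/\mathbb{Q}_p$ is ramified but not totally ramified. Let $r\in\mathbb{Z}/(q-1)\mathbb{Z}$ be such that $1\le r_i\le p-2$ for all $i\in\mathbb{Z}/f\mathbb{Z}$. If $E$ is an infinite field, then $V_{2,r}$ has infinitely many $\mathrm{GL}_2(\mathcal{O}/\mathfrak{m}^2)$-submodules.
   Context: Let $p$ be an odd prime, $F/\mathbb{Q}_p$ a finite extension with valuation ring $\mathcal{O}$, maximal ideal $\mathfrak{m}$, ramification index $e$, and residue field $k$ of cardinality $q=p^f$; $E$ is an extension field of $k$. For $r\in\mathbb{Z}/(q-1)\mathbb{Z}$, the digits $r_i\in\{0,\dots,p-1\}$ ($0\le i\le f-1$, indices viewed in $\mathbb{Z}/f\mathbb{Z}$) are defined by letting $\sum_{i=0}^{f-1}r_ip^i$ be the representative of $r$ in $\{1,\dots,q-1\}$. $V_{2,r}$ is the $E$-representation $\mathrm{Ind}_{B_2}^{G_2}\chi_r$ of $G_2=\mathrm{GL}_2(\mathcal{O}/\mathfrak{m}^2)$, where $B_2\le G_2$ is the subgroup of upper triangular matrices and $\chi_r:B_2\to k^\times\subseteq E^\times$ is $\begin{pmatrix}a&b\\0&d\end{pmatrix}\mapsto(d\bmod\mathfrak{m})^r$. *)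

(* Defs.v *)
From HB Require Import structures.
From mathcomp Require Import all_boot all_order all_algebra all_field.
From mathcomp Require Import boolp classical_sets functions cardinality.

Set Implicit Arguments.
Unset Strict Implicit.
Unset Printing Implicit Defensive.

Import GRing.Theory Num.Theory Order.TTheory.
Local Open Scope ring_scope.

Section ClassicalUnits.
Variable R : comNzRingType.
Implicit Types x y : R.

Definition classical_unit x : bool := `[< exists y, y * x = 1 >].

Definition classical_inv x : R :=
  if pselect (exists y, y * x = 1) is left h then projT1 (cid h) else x.

Lemma classical_mulVr : {in classical_unit, left_inverse 1 classical_inv *%R}.
Proof.
move=> x /asboolP hx; rewrite /classical_inv; case: pselect => // h.
exact: projT2 (cid h).
Qed.

Lemma classical_unitPl x y : y * x = 1 -> classical_unit x.
Proof. by move=> h; apply/asboolP; exists y. Qed.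

Lemma classical_invr_out : {in [predC classical_unit], classical_inv =1 id}.
Proof.
by move=> x /asboolPn hx; rewrite /classical_inv; case: pselect.
Qed.

End ClassicalUnits.

(* Z_p is the inverse limit of the rings Z/p^n, where Z/p^n is represented by *)
(* the residues 0, ..., p^n - 1: a p-adic integer is a sequence x with        *)
(* x n = x n.+1 %% p ^ n. The primality proof is an index of the type because *)
(* the (integral domain) instances below need it.                             *)
Definition coherent (p : nat) (x : nat -> nat) : bool :=
  `[< forall n, x n = x n.+1 %% p ^ n >]%N.

Record padic_int (p : nat) (p_pr : prime p) := PadicInt {
  padic_res :> nat -> nat;
  _ : coherent p padic_res
}.

Section PadicIntegers.
Variables (p : nat) (p_pr : prime p).

Local Notation padic_int := (padic_int p_pr).
Local Notation coherent := (coherent p).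

HB.instance Definition _ := [isSub for @padic_res p p_pr].
HB.instance Definition _ := [Choice of padic_int by <:].

Implicit Types x y z : padic_int.

Lemma padic_coherent x n : x n = (x n.+1 %% p ^ n)%N.
Proof. by case: x => x /= /asboolP. Qed.

Lemma padic_res_mod x n : (x n %% p ^ n)%N = x n.
Proof. by rewrite [in LHS]padic_coherent modn_mod -padic_coherent. Qed.

Lemma padic_int_eq x y : x =1 y -> x = y.
Proof. by move=> exy; apply/val_inj/funext. Qed.

Lemma coherent_mod (u : nat -> nat) :
  (forall n, u n = u n.+1 %[mod p ^ n])%N -> coherent (fun n => u n %% p ^ n)%N.
Proof.
move=> hu; apply/asboolP => n; rewrite hu expnSr modn_dvdm //.
exact: dvdn_mulr.
Qed.

Lemma padic_eqmod x n : x n = x n.+1 %[mod p ^ n].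
Proof. by rewrite [in LHS]padic_coherent modn_mod. Qed.

Fact padic_zero_subproof : coherent (fun n => 0 %% p ^ n)%N.
Proof. exact: coherent_mod. Qed.

Fact padic_one_subproof : coherent (fun n => 1 %% p ^ n)%N.
Proof. exact: coherent_mod. Qed.

Fact padic_add_subproof x y : coherent (fun n => (x n + y n) %% p ^ n)%N.
Proof.
by apply: (@coherent_mod (fun n => x n + y n)%N) => n;
  rewrite -modnDm !padic_eqmod modnDm.
Qed.

Fact padic_mul_subproof x y : coherent (fun n => (x n * y n) %% p ^ n)%N.
Proof.
by apply: (@coherent_mod (fun n => x n * y n)%N) => n;
  rewrite -modnMm !padic_eqmod modnMm.
Qed.

Lemma padic_res_lt x n : (x n < p ^ n)%N.
Proof. by rewrite padic_coherent ltn_mod expn_gt0 prime_gt0. Qed.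

Fact padic_opp_subproof x : coherent (fun n => (p ^ n - x n) %% p ^ n)%N.
Proof.
apply: (@coherent_mod (fun n => p ^ n - x n)%N) => n.
apply/eqP; rewrite -(eqn_modDr (x n)) subnK; last exact/ltnW/padic_res_lt.
rewrite -modnDmr padic_eqmod modnDmr subnK; last exact/ltnW/padic_res_lt.
by rewrite modnn expnSr modnMr.
Qed.

Definition padic_zero : padic_int := PadicInt p_pr padic_zero_subproof.
Definition padic_one : padic_int := PadicInt p_pr padic_one_subproof.
Definition padic_opp x : padic_int := PadicInt p_pr (padic_opp_subproof x).
Definition padic_add x y : padic_int := PadicInt p_pr (padic_add_subproof x y).
Definition padic_mul x y : padic_int := PadicInt p_pr (padic_mul_subproof x y).

Fact padic_addA : associative padic_add.
Proof. by move=> x y z; apply: padic_int_eq => n /=; rewrite modnDml modnDmr addnA. Qed.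

Fact padic_addC : commutative padic_add.
Proof. by move=> x y; apply: padic_int_eq => n /=; rewrite addnC. Qed.

Fact padic_add0 : left_id padic_zero padic_add.
Proof. by move=> x; apply: padic_int_eq => n /=; rewrite modnDml add0n padic_res_mod. Qed.

Fact padic_addN : left_inverse padic_zero padic_opp padic_add.
Proof.
move=> x; apply: padic_int_eq => n /=.
by rewrite modnDml subnK ?modnn ?mod0n //; exact/ltnW/padic_res_lt.
Qed.

Fact padic_mulA : associative padic_mul.
Proof. by move=> x y z; apply: padic_int_eq => n /=; rewrite modnMml modnMmr mulnA. Qed.

Fact padic_mulC : commutative padic_mul.
Proof. by move=> x y; apply: padic_int_eq => n /=; rewrite mulnC. Qed.

Fact padic_mul1 : left_id padic_one padic_mul.
Proof. by move=> x; apply: padic_int_eq => n /=; rewrite modnMml mul1n padic_res_mod. Qed.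

Fact padic_mulDl : left_distributive padic_mul padic_add.
Proof.
move=> x y z; apply: padic_int_eq => n /=.
by rewrite modnMml modnDm mulnDl.
Qed.

HB.instance Definition _ := GRing.isZmodule.Build padic_int
  padic_addA padic_addC padic_add0 padic_addN.

Fact padic_one_neq0 : padic_one != 0 :> padic_int.
Proof.
apply/eqP => /(congr1 (fun x : padic_int => x 1)) /=.
by rewrite expn1 mod0n modn_small ?prime_gt1.
Qed.

HB.instance Definition _ := GRing.Zmodule_isComNzRing.Build padic_int
  padic_mulA padic_mulC padic_mul1 padic_mulDl padic_one_neq0.

HB.instance Definition _ := GRing.ComNzRing_hasMulInverse.Build padic_int
  (@classical_mulVr padic_int) (@classical_unitPl padic_int)
  (@classical_invr_out padic_int).

Lemma padic_eqmodD x n m : x n = x (n + m)%N %[mod p ^ n].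
Proof.
elim: m => [|m IHm]; first by rewrite addn0.
rewrite IHm addnS [x (n + m)%N]padic_coherent modn_dvdm //.
by rewrite expnD dvdn_mulr.
Qed.

Fact padic_idomain x y : x * y = 0 -> (x == 0) || (y == 0).
Proof.
have neq0 z : z != 0 -> exists n, forall m, ~~ (p ^ n %| z (n + m))%N.
  move=> z0; apply: contrapT => hz; case/eqP: z0; apply: padic_int_eq => n /=.
  rewrite mod0n -padic_res_mod; apply: contrapT => zn; apply: hz; exists n => m.
  by apply/negP; rewrite /dvdn -padic_eqmodD => /eqP.
move=> xy0; case: eqVneq => //= /neq0[n hx]; apply: contraT => /neq0[m hy].
have {hx} := hx m; have {hy} := hy n; rewrite addnC.
have : (p ^ (n + m) %| x (n + m) * y (n + m))%N.
  by move/(congr1 (fun z : padic_int => z (n + m)%N)): xy0;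
    rewrite /= mod0n => /eqP.
set a := x _; set b := y _ => hab hb ha.
have a0 : (0 < a)%N by case: a ha {hab} => //; rewrite dvdn0.
have b0 : (0 < b)%N by case: b hb {hab} => //; rewrite dvdn0.
move: ha hb hab; rewrite !pfactor_dvdn ?muln_gt0 ?a0 // lognM // -!ltnNge.
by move=> la lb; rewrite leqNgt -addSn leq_add // ltnW.
Qed.

HB.instance Definition _ :=
  GRing.ComUnitRing_isIntegral.Build padic_int padic_idomain.

Definition padic := {fraction padic_int}.

End PadicIntegers.

HB.instance Definition _ (p : nat) (p_pr : prime p) :=
  GRing.Field.on (padic p_pr).

(* The normalized valuation of a finite extension F of Q_p, which exists and  *)
(* is unique: the surjective discrete valuation lying over the p-adic one,    *)
(* i.e. whose valuation ring contains Z_p and whose maximal ideal contains p. *)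
(* Its value at 0, which is conventionally +oo, is left unspecified.          *)
Record normalized_valuation (p : nat) (p_pr : prime p)
    (F : fieldExtType (padic p_pr)) := NormalizedValuation {
  nval :> F -> int;
  nvalM : forall x y, x != 0 -> y != 0 -> nval (x * y) = nval x + nval y;
  nvalD : forall x y, x != 0 -> y != 0 -> x + y != 0 ->
    Num.min (nval x) (nval y) <= nval (x + y);
  nval_surj : forall n : int, exists2 x, x != 0 & nval x = n;
  nval_padic_int : forall z : padic_int p_pr, z != 0 ->
    0 <= nval (FracField.tofrac z)%:A;
  nval_prime : 0 < nval p%:R
}.

Section IdealProduct.
Variable R : comNzRingType.

Definition ideal_prod (I J : {pred R}) : {pred R} := fun x =>
  `[< exists s : seq (R * R),
      {in s, forall ab, (ab.1 \in I) /\ (ab.2 \in J)} /\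
      x = \sum_(ab <- s) ab.1 * ab.2 >].

Lemma ideal_prod_sub (I J : idealr R) : {subset ideal_prod I J <= I}.
Proof.
move=> x /asboolP[s [hs ->]]; rewrite big_seq; apply: rpred_sum => ab /hs[ha _].
by rewrite mulrC idealMr.
Qed.

Fact ideal_prod_closed (I J : idealr R) : idealr_closed (ideal_prod I J).
Proof.
split.
- by apply/asboolP; exists [::]; rewrite big_nil.
- by apply/negP => /ideal_prod_sub; rewrite idealr1.
- move=> a x y /asboolP[s [hs ->]] /asboolP[t [ht ->]]; apply/asboolP.
  exists ([seq (a * ab.1, ab.2) | ab <- s] ++ t); split.
    move=> ab; rewrite mem_cat => /orP[/mapP[cd /hs[hc hd] ->]|/ht //].
    by split => //=; exact: idealMr.
  rewrite big_cat big_map /= mulr_sumr; congr (_ + _).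
  by apply: eq_bigr => ab _; rewrite mulrA.
Qed.

HB.instance Definition _ (I J : idealr R) :=
  isIdealr.Build R (ideal_prod I J) (ideal_prod_closed I J).

End IdealProduct.

Section ValuationRing.
Variables (p : nat) (p_pr : prime p) (F : fieldExtType (padic p_pr)).
Variable v : normalized_valuation F.

Definition ramification_index : int := v p%:R.

Definition in_valuation_ring : {pred F} := fun x => (x == 0) || (0 <= v x).

Lemma nval1 : v 1 = 0.
Proof.
have := nvalM v (oner_neq0 F) (oner_neq0 F); rewrite mulr1 => /eqP.
by rewrite -subr_eq0 opprD addrA subrr sub0r oppr_eq0 => /eqP.
Qed.

Lemma nvalN1 : v (-1) = 0.
Proof.
have N10 : -1 != 0 :> F by rewrite oppr_eq0 oner_neq0.
have := nvalM v N10 N10; rewrite mulrNN mulr1 nval1 => /esym/eqP.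
by rewrite -mulr2n mulrn_eq0 => /eqP.
Qed.

Lemma nvalN x : x != 0 -> v (- x) = v x.
Proof.
move=> x0; rewrite -mulN1r nvalM ?oppr_eq0 ?oner_neq0 //.
by rewrite nvalN1 add0r.
Qed.

Fact in_valuation_ring_subring : subring_closed in_valuation_ring.
Proof.
split=> [|x y|x y]; rewrite /in_valuation_ring !unfold_in.
- by rewrite nval1 lexx orbT.
- have [->|x0] := eqVneq x 0; have [->|y0] := eqVneq y 0 => //=.
  + by rewrite subrr eqxx.
  + by rewrite sub0r oppr_eq0 (negPf y0) nvalN.
  + by rewrite subr0 (negPf x0).
  case: eqVneq => //= xy0 hx hy; apply: le_trans (nvalD v x0 _ xy0).
    by rewrite le_min hx nvalN.
  by rewrite oppr_eq0.
- have [->|x0] := eqVneq x 0; first by rewrite mul0r eqxx.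
  have [->|y0] := eqVneq y 0; first by rewrite mulr0 eqxx.
  by move=> /= hx hy; rewrite mulf_eq0 (negPf x0) (negPf y0) nvalM // addr_ge0.
Qed.

HB.instance Definition _ :=
  GRing.isSubringClosed.Build F in_valuation_ring in_valuation_ring_subring.

Record valuation_ring := ValuationRing {
  valuation_ring_val :> F;
  _ : valuation_ring_val \in in_valuation_ring
}.

HB.instance Definition _ := [isSub for valuation_ring_val].
HB.instance Definition _ := [Choice of valuation_ring by <:].
HB.instance Definition _ :=
  [SubChoice_isSubComNzRing of valuation_ring by <:].

Definition max_ideal : {pred valuation_ring} :=
  fun x => (x == 0) || (0 < v (val x)).

Fact max_ideal_closed : idealr_closed max_ideal.
Proof.
split; rewrite /max_ideal ?unfold_in ?eqxx //.
  by rewrite oner_eq0 rmorph1 nval1 ltxx.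
move=> a x y; rewrite !unfold_in -!(inj_eq val_inj) rmorphD rmorphM rmorph0 /=.
move: (valP a); rewrite unfold_in /in_valuation_ring /=.
move: (val a) (val x) (val y) => {a x y} /= a x y ha hx hy.
have {ha hx} : (a * x == 0) || (0 < v (a * x)).
  have [->|a0] := eqVneq a 0; first by rewrite mul0r eqxx.
  have [->|x0] := eqVneq x 0; first by rewrite mulr0 eqxx.
  rewrite (negPf a0) (negPf x0) /= in ha hx.
  by rewrite nvalM // ltr_wpDl // orbT.
move: (a * x) => z hz.
have [->|z0] := eqVneq z 0; first by rewrite add0r.
have [->|y0] := eqVneq y 0; first by rewrite addr0.
rewrite (negPf z0) (negPf y0) /= in hz hy.
case: eqVneq => //= zy0; apply: lt_le_trans (nvalD v z0 y0 zy0).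
by rewrite lt_min hz.
Qed.

HB.instance Definition _ :=
  isIdealr.Build valuation_ring max_ideal max_ideal_closed.

Definition max_ideal2 : {pred valuation_ring} := ideal_prod max_ideal max_ideal.

HB.instance Definition _ := Idealr.on max_ideal2.

Definition residue_field := {ideal_quot max_ideal}.

Definition trunc_ring := {ideal_quot max_ideal2}.

End ValuationRing.

Arguments in_valuation_ring {p p_pr F} v _.
Arguments max_ideal {p p_pr F} v _.
Arguments max_ideal2 {p p_pr F} v _.

Section Quotients.
Variables (p : nat) (p_pr : prime p) (F : fieldExtType (padic p_pr)).
Variable v : normalized_valuation F.
Local Notation k := (residue_field v).
Local Notation A := (trunc_ring v).
Local Open Scope quotient_scope.

HB.instance Definition _ := GRing.ComNzRing.on k.
HB.instance Definition _ := Quotient.on k.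
HB.instance Definition _ := GRing.ComNzRing.on A.
HB.instance Definition _ := Quotient.on A.

HB.instance Definition _ := GRing.ComNzRing_hasMulInverse.Build A
  (@classical_mulVr A) (@classical_unitPl A) (@classical_invr_out A).

Definition reduce (a : A) : k := \pi_k (repr a).

Lemma reduce_pi (x : valuation_ring v) : reduce (\pi_A x) = \pi_k x.
Proof.
apply/eqP; rewrite -Quotient.idealrBE.
have /ideal_prod_sub // : repr (\pi_A x) - x \in max_ideal2 v.
by rewrite Quotient.idealrBE reprK.
Qed.

Lemma residue_field_mulV (a : k) : a != 0 -> classical_inv a * a = 1.
Proof.
move=> a0; apply: classical_mulVr; apply/asboolP.
rewrite -[a]reprK in a0 *; move: (repr a) a0 => {a} x.
rewrite -(rmorph0 (\pi_k : valuation_ring v -> k)) -Quotient.idealrBE subr0.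
rewrite unfold_in /max_ideal negb_or -leNgt => /andP[x0 vx].
have vx0 : val x != 0 by rewrite -(inj_eq val_inj) rmorph0 in x0.
have Vx0 : (val x)^-1 != 0 by rewrite invr_eq0.
have vV : (val x)^-1 \in in_valuation_ring v.
  rewrite unfold_in /in_valuation_ring (negPf Vx0) /=.
  have := nvalM v Vx0 vx0; rewrite mulVf // nval1 => /esym/eqP.
  by rewrite addr_eq0 => /eqP ->; rewrite oppr_ge0.
exists (\pi_k (ValuationRing vV)); rewrite -rmorphM -(rmorph1 (\pi_k)).
by congr (\pi_k _); apply/val_inj; rewrite rmorphM rmorph1 /= mulVf.
Qed.

Lemma residue_field_inv0 : classical_inv (0 : k) = 0.
Proof.
apply: classical_invr_out; apply/asboolPn => -[y].
by rewrite mulr0 => /esym/eqP; rewrite oner_eq0.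
Qed.

HB.instance Definition _ := GRing.ComNzRing_isField.Build k
  residue_field_mulV residue_field_inv0.

End Quotients.

Section GeneralLinear.
Variables (n : nat) (A : comUnitRingType).

Record general_linear := GeneralLinear {
  gl_mx :> 'M[A]_n;
  _ : gl_mx \in unitmx
}.

HB.instance Definition _ := [isSub for gl_mx].
HB.instance Definition _ := [Choice of general_linear by <:].

Implicit Types g h : general_linear.

Fact gl_one_subproof : (1%:M : 'M[A]_n) \in unitmx.
Proof. exact: unitmx1. Qed.

Fact gl_mul_subproof g h : gl_mx g *m gl_mx h \in unitmx.
Proof. by rewrite unitmx_mul (valP g) (valP h). Qed.

Fact gl_inv_subproof g : invmx (gl_mx g) \in unitmx.
Proof. by rewrite unitmx_inv (valP g). Qed.

Definition gl_one := GeneralLinear gl_one_subproof.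
Definition gl_mul g h := GeneralLinear (gl_mul_subproof g h).
Definition gl_inv g := GeneralLinear (gl_inv_subproof g).

Fact gl_mulA : associative gl_mul.
Proof. by move=> g h l; apply/val_inj; rewrite /= mulmxA. Qed.

Fact gl_mul1 : left_id gl_one gl_mul.
Proof. by move=> g; apply/val_inj; rewrite /= mul1mx. Qed.

Fact gl_1mul : right_id gl_one gl_mul.
Proof. by move=> g; apply/val_inj; rewrite /= mulmx1. Qed.

Fact gl_mulV : left_inverse gl_one gl_inv gl_mul.
Proof. by move=> g; apply/val_inj; rewrite /= mulVmx // (valP g). Qed.

Fact gl_Vmul : right_inverse gl_one gl_inv gl_mul.
Proof. by move=> g; apply/val_inj; rewrite /= mulmxV // (valP g). Qed.

HB.instance Definition _ :=
  isGroup.Build general_linear gl_mulA gl_mul1 gl_1mul gl_mulV gl_Vmul.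

End GeneralLinear.

Local Open Scope classical_set_scope.

Section Induction.
Variables (G : groupType) (E : fieldType).

(* The values of chi outside B are irrelevant.                                *)
Definition induced (B : set G) (chi : G -> E) : set (G -> E) :=
  [set phi | forall b g, B b -> phi (b * g)%g = chi b * phi g].

Definition translate (g : G) (phi : G -> E) : G -> E := fun x => phi (x * g)%g.

Definition submodule (V U : set (G -> E)) : Prop :=
  [/\ U `<=` V,
      U (fun=> 0),
      forall (a : E) phi psi, U phi -> U psi ->
        U (fun x => a * phi x + psi x) &
      forall g phi, U phi -> U (translate g phi)].

End Induction.

Section PrincipalSeries.
Variables (p : nat) (p_pr : prime p) (F : fieldExtType (padic p_pr)).
Variable v : normalized_valuation F.
Variables (E : fieldType) (iota : {rmorphism residue_field v -> E}).

Definition G2 : groupType := general_linear 2 (trunc_ring v).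

Definition B2 : set G2 := [set g : G2 | gl_mx g 1 0 = 0].

(* A power with exponent in Z/(q - 1) is taken through a representative in    *)
(* nat, which is harmless as it is only applied to elements of k^x.           *)
Definition chi (r : nat) (g : G2) : E := iota (reduce (gl_mx g 1 1) ^+ r).

Definition V2 (r : nat) : set (G2 -> E) := induced B2 (chi r).

End PrincipalSeries.

(* The representative of r in {1, ..., n}, assuming 1 < n, so that 'Z_n is    *)
(* indeed Z/n.                                                                *)
Definition pos_repr (n : nat) (r : 'Z_n) : nat := if r == 0 then n else r.

Definition is_digits (p f : nat) (r : 'Z_((p ^ f).-1)) (d : 'I_f -> 'I_p) :
  Prop := (\sum_(i < f) d i * p ^ i)%N = pos_repr r.

(* Main.v *)
Require Import Defs.
From HB Require Import structures.
From mathcomp Require Import all_boot all_order all_algebra all_field.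
From mathcomp Require Import boolp classical_sets functions cardinality.
From mathcomp Require Import finmap ring zify.

Set Implicit Arguments.
Unset Strict Implicit.
Unset Printing Implicit Defensive.

Import GRing.Theory Num.Theory Order.TTheory.
Local Open Scope classical_set_scope.
Local Open Scope card_scope.
Local Open Scope ring_scope.

(** Put [A = O/m^2] and [q = #|k|]. Since [e >= 2], [p] vanishes in [A], so [A]
    is [k[eps]/(eps^2)], where [eps] is the class of a uniformizer. Write its
    elements as [x0 + x1 eps]; what matters is the reduction
    [red : x0 + x1 eps |-> x0] and the derivation [delta : x0 + x1 eps |-> x1]
    ([trunc_ring_derivation]).

    A function in [V] depends on [g] only through the bottom row [(c, d)], and,
    as the character is trivial on [1 + m], only through the vector
    [u = (c0, d0)] of [k^2 \ 0] and the quantity [D = c0 d1 - d0 c1]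
    ([tangent_wedge]). Right translation by [h] acts on [u] through the
    reduction of [h] and replaces [D] by [det(h) D + s], where [s]
    depends on [u] and [h] only ([tangent_wedge_mul]). It is thus affine in [D], and also affine in
    [D^p] when applied to [D^p], because the characteristic is [p]. Hence the
    functions
      [a_u(D) + b_u(D^p)],  with [deg a_u <= n0] and [deg b_u <= n1],
    form a subrepresentation for all [n0] and [n1], and the top coefficients of
    [a] and [b] can be read off independently modulo the lower ones.

    Let [n0] be the lowest digit of [r] and [r = n0 + p n1]; then [n0 > 0], and
    [n1 > 0] because there are at least two digits. The top coefficient of [a]
    is a function on [k^2 \ 0] of weight [r - 2 n0], twisted by [det^n0], and
    that of [b] has weight [r - 2 p n1] and twist [det^(p n1)]. As
    [n0 + p n1 = r], these two principal series of GL_2(k) are induced from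
    characters of the torus that are exchanged by the Weyl group, so there is a
    nonzero intertwining operator between them:
      [T phi (u) = sum_w (u /\ w)^m phi(w)],  [m = n0 - p n1 mod q - 1].
    For every [lam] in [E], the condition (top coefficient of [b]) =
    [lam T] (top coefficient of [a]) cuts out a subrepresentation
    ([graph_submodule_closed]). Different [lam] give different ones
    ([graph_submodule_inj]): for a given nonzero [u] the quantity [D] takes all
    [q] values in [k] and the exponents of [D] that occur are below [q], so a
    function determines its top coefficients ([coefs_of_wedge_polynomial]), and
    [T] does not vanish ([intertwiner_axis_fun]). *)

(** * Fields given by an enumeration *)

Lemma card_eq_enum (T : choiceType) n : [set: T] #= `I_n ->
  exists s : seq T, [/\ uniq s, forall x, x \in s & size s = n].
Proof.
move=> cardT; have finT : finite_set [set: T] by exists n.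
have /finite_fsetP[X defX] := finT.
exists (X : seq T); split.
- exact: fset_uniq.
- by move=> x; have : [set: T] x by []; rewrite defX.
- by apply/card_eq_fsetP; rewrite -defX.
Qed.

Lemma perm_map_enum (T : eqType) (s : seq T) (g : T -> T) :
  uniq s -> (forall x, x \in s) -> injective g -> perm_eq (map g s) s.
Proof.
move=> us ins injg; have umap : uniq (map g s) by rewrite map_inj_uniq.
have [|_ eqs] := uniq_min_size umap (fun x _ => ins x).
  by rewrite size_map.
exact: uniq_perm.
Qed.

(** The residue field is known to be finite only through a cardinality, so the
    identities over a finite field are derived for a field with an explicit
    enumeration of its elements. *)
Section EnumeratedField.
Variables (k : fieldType) (ks : seq k).
Hypotheses (ks_uniq : uniq ks) (ks_all : forall x, x \in ks).
Local Notation q := (size ks).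

Lemma prod_nonzero_neq0 : (\prod_(y <- ks | y != 0) y : k) != 0.
Proof. by rewrite prodf_seq_neq0; apply/allP => y _; apply/implyP. Qed.

Lemma count_nonzero : count (fun y : k => y != 0) ks = q.-1.
Proof.
rewrite -(count_predC (pred1 0) ks) count_uniq_mem // ks_all add1n /=.
by apply: eq_count => y.
Qed.

(** Multiplication by a nonzero [x] permutes the nonzero elements, so their
    product is multiplied by [x ^+ q.-1] and by 1. *)
Lemma enum_expf_pred x : (x : k) != 0 -> x ^+ q.-1 = 1.
Proof.
move=> x0; apply: (mulIf prod_nonzero_neq0); rewrite mul1r.
rewrite -[in RHS](perm_big _ (perm_map_enum ks_uniq ks_all (mulfI x0))).
rewrite big_map [in RHS](eq_bigl (fun y => y != 0)) => [|y].
  rewrite big_split; congr (_ * _).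
  by rewrite big_const_seq [count _ _]count_nonzero iter_mulr_1.
by rewrite mulf_eq0 (negPf x0).
Qed.

Lemma size_enum_gt0 : (0 < q)%N.
Proof. by case: ks (ks_all 0). Qed.

Lemma enum_expf (x : k) : x ^+ q = x.
Proof.
have [->|x0] := eqVneq x 0.
  by rewrite expr0n; case: ks (ks_all 0).
by rewrite -(prednK size_enum_gt0) exprS enum_expf_pred // mulr1.
Qed.

(** Translation by 1 permutes the field, so the sum of its elements is unchanged
    when it is increased by [q] times 1. *)
Lemma size_enum_eq0 : q%:R = 0 :> k.
Proof.
apply: (addIr (\sum_(x <- ks) x)).
rewrite add0r -[RHS](perm_big _ (perm_map_enum ks_uniq ks_all (@addrI k 1))).
by rewrite big_map big_split /= big_const_seq count_predT iter_addr_0.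
Qed.

Lemma sum_enum_expf_pred : (1 < q)%N -> \sum_(y <- ks) y ^+ q.-1 = -1 :> k.
Proof.
move=> q1; rewrite (bigID (fun y => y != 0)) /=.
rewrite [X in _ + X]big1 ?addr0 => [|y]; last first.
  by rewrite negbK => /eqP ->; rewrite expr0n; case: (q) q1 => [|[]].
rewrite (eq_bigr (fun=> 1)) => [|y]; last exact: enum_expf_pred.
rewrite big_const_seq [count _ _]count_nonzero iter_addr_0.
apply: (addIr 1); rewrite addNr -size_enum_eq0.
by rewrite -[in RHS](prednK size_enum_gt0) -natr1.
Qed.

End EnumeratedField.

(** * Rings whose reduction has a square-zero principal kernel *)

Section SquareZeroKernel.
Variables (A : comNzRingType) (k : fieldType) (red : {rmorphism A -> k}).

(** [(red, delta)] is then a surjective ring morphism from [A] to the dual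
    numbers over [k]. *)
Definition tangent_derivation (delta : A -> k) : Prop :=
  [/\ forall a b, delta (a + b) = delta a + delta b,
      forall a b, delta (a * b) = red a * delta b + delta a * red b &
      forall x y, exists2 a, red a = x & delta a = y].

(** The annihilator of [eps] is the ideal that it generates, namely the kernel
    of [red]. *)
Variable eps : A.
Hypothesis red_surj : forall x, exists a, red a = x.
Hypothesis red_eq0 : forall a, red a = 0 -> exists b, a = eps * b.
Hypothesis eps_mul_eq0 : forall b, (eps * b == 0) = (red b == 0).
Hypothesis red_eps : red eps = 0.

Lemma square_zero_inv a : red a != 0 -> exists b, b * a = 1.
Proof.
move=> a0; have [b rb] := red_surj (red a)^-1.
have : red (b * a - 1) = 0 by rewrite rmorphB rmorphM rmorph1 rb mulVf ?subrr.
case/red_eq0 => c /eqP; rewrite subr_eq => /eqP baE.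
have eps2 : eps * eps = 0 by apply/eqP; rewrite eps_mul_eq0 red_eps.
exists ((1 - eps * c) * b); rewrite -mulrA baE.
suff -> : (1 - eps * c) * (eps * c + 1) = 1 - (eps * eps) * c * c.
  by rewrite eps2 !mul0r subr0.
ring.
Qed.

(** [a - a ^+ n] is killed by [red], so it is [eps * b], and [delta a] is the
    reduction of [b]. The powers [a ^+ n] are the Teichmueller representatives:
    [delta] vanishes on them, and [red] is a bijection from them to [k]. *)
Lemma square_zero_derivation n :
    (1 < n)%N -> (forall x : k, x ^+ n = x) ->
    (forall a b : A, (a + b) ^+ n = a ^+ n + b ^+ n) ->
  exists delta : A -> k, tangent_derivation delta.
Proof.
move=> n1 expn_id frobD.
have epsK a b : eps * a = eps * b -> red a = red b.
  move=> /eqP; rewrite -subr_eq0 -mulrBr eps_mul_eq0 rmorphB subr_eq0.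
  by move=> /eqP.
have epsX : eps ^+ n = 0.
  apply/eqP; case: n n1 {expn_id frobD} => [|[|n]] // _.
  by rewrite exprS eps_mul_eq0 exprS rmorphM red_eps mul0r.
have /choice[g gE] (a : A) : exists b : A, a - a ^+ n = eps * b.
  by apply: red_eq0; rewrite rmorphB rmorphXn expn_id subrr.
exists (fun a => red (g a)); split=> [a b|a b|x y].
- by rewrite -rmorphD; apply: epsK; rewrite mulrDr -!gE frobD; ring.
- rewrite -[X in _ + _ * X]expn_id -rmorphXn -!rmorphM -rmorphD; apply: epsK.
  by rewrite mulrDr mulrCA [eps * (g a * _)]mulrA -!gE exprMn; ring.
- have [a ra] := red_surj x; have [b rb] := red_surj y.
  exists (a ^+ n + eps * b).
    by rewrite rmorphD rmorphM rmorphXn ra red_eps mul0r addr0 expn_id.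
  rewrite -rb; apply: epsK; rewrite -gE frobD exprMn epsX mul0r addr0.
  suff -> : (a ^+ n) ^+ n = a ^+ n by rewrite addrAC subrr add0r.
  have aE : a = a ^+ n + eps * g a by rewrite -gE addrC subrK.
  by rewrite [in RHS]aE frobD exprMn epsX mul0r addr0.
Qed.

End SquareZeroKernel.

(** * Affine substitutions in polynomials *)

Section AffineSubstitution.
Variables (R : comNzRingType) (c d : R).

Lemma size_affine_exp n : (size ((c *: 'X + d%:P) ^+ n)%R <= n.+1)%N.
Proof.
apply: leq_trans (size_poly_exp_leq _ _) _.
rewrite ltnS -[leqRHS]mul1n leq_mul2r.
apply/orP; right; rewrite -subn1 leq_subLR; apply: leq_trans (size_polyD _ _) _.
rewrite geq_max (leq_trans (size_scale_leq _ _)) ?size_polyX //.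
by rewrite (leq_trans (size_polyC_leq1 _)).
Qed.

Lemma coef_affine_exp n : ((c *: 'X + d%:P) ^+ n)`_n = c ^+ n.
Proof.
elim: n => [|n IHn]; first by rewrite !expr0 coefC.
rewrite exprS mulrDl -scalerAl coefD coefZ coefXM coefCM /= IHn exprS.
by rewrite [X in d * X]nth_default ?mulr0 ?addr0 // size_affine_exp.
Qed.

Lemma size_comp_affine (P : {poly R}) n :
  (size P <= n.+1)%N -> (size (P \Po (c *: 'X + d%:P)) <= n.+1)%N.
Proof.
move=> sP; rewrite comp_polyE; apply: leq_trans (size_sum _ _ _) _.
apply/bigmax_leqP => i _; apply: leq_trans (size_scale_leq _ _) _.
by apply: leq_trans (size_affine_exp i) _; apply: leq_trans sP.
Qed.

(** Affine substitutions rescale the top coefficient, whatever the lower ones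
    are: this is why conditions on top coefficients can be stable under
    translation. *)
Lemma coef_comp_affine (P : {poly R}) n : (size P <= n.+1)%N ->
  (P \Po (c *: 'X + d%:P))`_n = c ^+ n * P`_n.
Proof.
move=> sP; have sP' : (size (map_poly polyC P) <= n.+1)%N.
  by rewrite size_map_polyC.
rewrite [P \Po _](horner_coef_wide _ sP') coef_sum big_ord_recr /=.
rewrite big1 => [|i _].
  by rewrite add0r coef_map coefCM coef_affine_exp mulrC.
rewrite coef_map coefCM [X in _ * X]nth_default ?mulr0 //.
exact: leq_trans (size_affine_exp i) _.
Qed.

End AffineSubstitution.

(** * The truncated valuation ring *)

Section TruncatedRing.
Variables (p : nat) (p_pr : prime p) (F : fieldExtType (padic p_pr)).
Variable v : normalized_valuation F.
Local Notation O := (valuation_ring v).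
Local Notation k := (residue_field v).
Local Notation A := (trunc_ring v).
Local Open Scope quotient_scope.

Fact reduce_zmod_morphism : zmod_morphism (@reduce p p_pr F v).
Proof.
move=> a b; rewrite -[a]reprK -[b]reprK -rmorphB !reduce_pi.
exact: rmorphB.
Qed.

Fact reduce_monoid_morphism : monoid_morphism (@reduce p p_pr F v).
Proof.
split; first by rewrite -(rmorph1 (\pi_A)) reduce_pi rmorph1.
move=> a b; rewrite -[a]reprK -[b]reprK -rmorphM !reduce_pi.
exact: rmorphM.
Qed.

HB.instance Definition _ :=
  GRing.isZmodMorphism.Build A k (@reduce p p_pr F v) reduce_zmod_morphism.
HB.instance Definition _ :=
  GRing.isMonoidMorphism.Build A k (@reduce p p_pr F v) reduce_monoid_morphism.

Lemma reduce_surj (x : k) : exists a : A, reduce a = x.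
Proof. by exists (\pi_A (repr x)); rewrite reduce_pi reprK. Qed.

Definition nval_ge (n : int) : {pred F} := fun x => (x == 0) || (n <= v x).

Lemma nval_geD n x y :
  x \in nval_ge n -> y \in nval_ge n -> x + y \in nval_ge n.
Proof.
rewrite !unfold_in /nval_ge.
have [->|x0] := eqVneq x 0; first by rewrite add0r.
have [->|y0] := eqVneq y 0; first by rewrite addr0 (negPf x0).
case: eqVneq => //= xy0 hx hy; apply: le_trans (nvalD v x0 y0 xy0).
by rewrite le_min hx.
Qed.

Lemma nval_geM n m x y :
  x \in nval_ge n -> y \in nval_ge m -> x * y \in nval_ge (n + m).
Proof.
rewrite !unfold_in /nval_ge.
have [->|x0] := eqVneq x 0; first by rewrite mul0r eqxx.
have [->|y0] := eqVneq y 0; first by rewrite mulr0 eqxx.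
by move=> /= hx hy; rewrite mulf_eq0 (negPf x0) (negPf y0) nvalM // lerD.
Qed.

Lemma in_max_idealE (x : O) : (x \in max_ideal v) = (val x \in nval_ge 1).
Proof.
rewrite unfold_in /max_ideal unfold_in /nval_ge -(inj_eq val_inj) rmorph0.
by rewrite gtz0_ge1.
Qed.

Lemma in_max_ideal2_ge (x : O) : x \in max_ideal2 v -> val x \in nval_ge 2.
Proof.
move=> /asboolP[s [hs ->]]; rewrite rmorph_sum big_seq /=.
elim/big_ind: _ => [|y z|ab /hs[]]; first by rewrite unfold_in /nval_ge eqxx.
  exact: nval_geD.
by rewrite !in_max_idealE; exact: nval_geM.
Qed.

Section Uniformizer.
Variable pi : O.
Hypotheses (pi0 : val pi != 0) (v_pi : v (val pi) = 1).

Lemma uniformizer_factor (n : int) (x : O) :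
  0 <= n -> val x \in nval_ge (1 + n) ->
  exists2 y : O, x = pi * y & val y \in nval_ge n.
Proof.
move=> n0 hx; pose z := val x / val pi.
have hz : z \in nval_ge n.
  rewrite -[n]addr0 -(subrr 1) addrA [n + 1]addrC; apply: nval_geM hx _.
  rewrite unfold_in /nval_ge; apply/orP; right.
  have := nvalM v (invr_neq0 pi0) pi0; rewrite mulVf // nval1 v_pi => /esym/eqP.
  by rewrite addr_eq0 => /eqP ->.
have zO : z \in in_valuation_ring v.
  move: hz; rewrite !unfold_in /nval_ge /in_valuation_ring.
  by case/orP => [->//|h]; rewrite (le_trans n0 h) orbT.
exists (ValuationRing zO); last exact: hz.
by apply: val_inj; rewrite rmorphM /= mulrCA mulfV ?mulr1.
Qed.

Lemma uniformizer_in_max_ideal : pi \in max_ideal v.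
Proof. by rewrite in_max_idealE unfold_in /nval_ge v_pi lexx orbT. Qed.

Lemma pi_ideal_quot_eq0 (I : idealr O) (x : O) :
  (\pi_{ideal_quot I} x == 0) = (x \in I).
Proof. by rewrite -(rmorph0 (\pi_{ideal_quot I})) -Quotient.idealrBE subr0. Qed.

(** The square of the maximal ideal is generated by products; the products with
    a uniformizer already exhaust the elements of valuation at least 2. *)
Lemma in_max_ideal2P (x : O) : (x \in max_ideal2 v) = (val x \in nval_ge 2).
Proof.
apply/idP/idP => [|/(@uniformizer_factor 1)[//|y -> hy]].
  exact: in_max_ideal2_ge.
apply/asboolP; exists [:: (pi, y)]; rewrite big_seq1; split=> // ab.
by rewrite inE => /eqP -> /=; rewrite uniformizer_in_max_ideal in_max_idealE.
Qed.

Lemma reduce_eq0 (a : A) :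
  reduce a = 0 -> exists b : A, a = \pi_A pi * b.
Proof.
rewrite -[a]reprK reduce_pi => /eqP; rewrite pi_ideal_quot_eq0 in_max_idealE.
move=> /(@uniformizer_factor 0)[//|y -> _].
by exists (\pi_A y); rewrite -rmorphM.
Qed.

Lemma uniformizer_mul_eq0 (b : A) : (\pi_A pi * b == 0) = (reduce b == 0).
Proof.
rewrite -[b]reprK reduce_pi -rmorphM !pi_ideal_quot_eq0.
rewrite in_max_ideal2P in_max_idealE.
move: (repr b) => {b} y.
apply/idP/idP => [/(@uniformizer_factor 1)[//|z eqz hz]|hy].
  suff -> : y = z by [].
  apply: val_inj; apply: (mulfI pi0); rewrite -!rmorphM; exact: congr1 eqz.
rewrite rmorphM; apply: (@nval_geM 1 1) => //.
by rewrite -in_max_idealE uniformizer_in_max_ideal.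
Qed.

Lemma reduce_uniformizer : reduce (\pi_A pi) = 0 :> k.
Proof.
by apply/eqP; rewrite reduce_pi pi_ideal_quot_eq0 uniformizer_in_max_ideal.
Qed.

(** Where ramification enters: [p] has valuation at least 2. *)
Lemma trunc_ring_pchar : 2 <= ramification_index v -> p%:R = 0 :> A.
Proof.
move=> e2; apply/eqP.
rewrite -(rmorph_nat (\pi_A)) pi_ideal_quot_eq0 in_max_ideal2P.
by rewrite rmorph_nat unfold_in /nval_ge e2 orbT.
Qed.

End Uniformizer.

Lemma exists_uniformizer : exists2 pi : O, val pi != 0 & v (val pi) = 1.
Proof.
have [x x0 vx] := nval_surj v 1.
have xO : x \in in_valuation_ring v.
  by rewrite unfold_in /in_valuation_ring vx orbT.
by exists (ValuationRing xO).
Qed.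

(** The kernel of reduction has square zero, so inverses lift from [k]. *)
Lemma reduce_neq0_unit (a : A) : reduce a != 0 -> a \is a GRing.unit.
Proof.
have [pi pi0 v_pi] := exists_uniformizer => a0; apply/asboolP.
exact: (square_zero_inv reduce_surj (reduce_eq0 pi0 v_pi)
  (uniformizer_mul_eq0 pi0 v_pi) (reduce_uniformizer v_pi) a0).
Qed.

Lemma trunc_ring_derivation (ks : seq k) (f : nat) :
    2 <= ramification_index v -> (0 < f)%N ->
    uniq ks -> (forall x, x \in ks) -> size ks = (p ^ f)%N ->
  exists delta : A -> k, tangent_derivation (@reduce p p_pr F v) delta.
Proof.
move=> e2 f0 ks_uniq ks_all size_ks; have [pi pi0 v_pi] := exists_uniformizer.
apply: (@square_zero_derivation _ _ _ _ reduce_surj (reduce_eq0 pi0 v_pi)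
  (uniformizer_mul_eq0 pi0 v_pi) (reduce_uniformizer v_pi) (p ^ f)).
- by rewrite -(exp1n f) ltn_exp2r ?prime_gt1.
- by move=> x; rewrite -size_ks enum_expf.
- move=> a b; apply: exprDn_pchar; rewrite pnatX; apply/orP; left.
  by rewrite pnatE // inE p_pr (trunc_ring_pchar pi0 v_pi) /=.
Qed.

End TruncatedRing.

(** * Subrepresentations given by graphs of an intertwining operator *)

Lemma det_mx22 (R : comNzRingType) (M : 'M[R]_2) :
  \det M = M 0 0 * M 1 1 - M 0 1 * M 1 0.
Proof.
rewrite (expand_det_row _ 0) !big_ord_recl big_ord0 addr0 /cofactor !det_mx11.
rewrite !mxE /= !expr0 expr1 !mul1r mulN1r mulrN.
by congr (_ * M _ _ - M _ _ * M _ _); apply: val_inj.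
Qed.

Section GraphSubmodules.
Variables (A : comUnitRingType) (k : fieldType) (red : {rmorphism A -> k}).
Variable delta : A -> k.
Hypothesis delta_tangent : tangent_derivation red delta.
Hypothesis red_neq0_unit : forall a, red a != 0 -> a \is a GRing.unit.
Variables (E : fieldType) (iota : {rmorphism k -> E}).
Variables (ks : seq k).
Hypotheses (ks_uniq : uniq ks) (ks_all : forall x, x \in ks).
Local Notation q := (size ks).
Local Notation G := (general_linear 2 A).
Implicit Types (g h : G) (u w : k * k).

Lemma gl_mulE g h i j :
  gl_mx (g * h)%g i j =
  gl_mx g i 0 * gl_mx h 0 j + gl_mx g i 1 * gl_mx h 1 j.
Proof.
rewrite mxE !big_ord_recl big_ord0 addr0.
by rewrite (_ : lift ord0 ord0 = 1) //; apply: val_inj.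
Qed.

Definition bottom_row g : k * k := (red (gl_mx g 1 0), red (gl_mx g 1 1)).

(** When [A] is the ring of dual numbers over [k], this and [bottom_row]
    determine the second row of [g] up to a factor in [1 + eps k]. *)
Definition tangent_wedge g : k :=
  red (gl_mx g 1 0) * delta (gl_mx g 1 1) -
  red (gl_mx g 1 1) * delta (gl_mx g 1 0).

Definition row_act h u : k * k :=
  (u.1 * red (gl_mx h 0 0) + u.2 * red (gl_mx h 1 0),
   u.1 * red (gl_mx h 0 1) + u.2 * red (gl_mx h 1 1)).

Definition wedge u w : k := u.1 * w.2 - u.2 * w.1.

Definition red_det h : k := red (\det (gl_mx h)).

Definition wedge_shift h u : k :=
  wedge (row_act h u) (u.1 * delta (gl_mx h 0 0) + u.2 * delta (gl_mx h 1 0),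
                       u.1 * delta (gl_mx h 0 1) + u.2 * delta (gl_mx h 1 1)).

Lemma red_detE h :
  red_det h = red (gl_mx h 0 0) * red (gl_mx h 1 1) -
              red (gl_mx h 0 1) * red (gl_mx h 1 0).
Proof. by rewrite /red_det det_mx22 rmorphB !rmorphM. Qed.

Lemma red_det_neq0 h : red_det h != 0.
Proof.
have := valP h; rewrite /= unitmxE => /(rmorph_unit red).
by rewrite unitfE.
Qed.

Lemma bottom_row_mul g h : bottom_row (g * h)%g = row_act h (bottom_row g).
Proof. by rewrite /bottom_row !gl_mulE !rmorphD !rmorphM. Qed.

(** By the Leibniz rule: the terms with a derivative of the bottom row of [g]
    recombine into its wedge, and the others involve its reduction only. *)
Lemma tangent_wedge_mul g h :
  tangent_wedge (g * h)%g =
  red_det h * tangent_wedge g + wedge_shift h (bottom_row g).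
Proof.
have [deltaD deltaM _] := delta_tangent.
rewrite /tangent_wedge !gl_mulE !rmorphD !rmorphM !deltaD !deltaM red_detE.
rewrite /wedge_shift /wedge /=; ring.
Qed.

Lemma borel_entry (b : G) : gl_mx b 1 0 = 0 -> red (gl_mx b 1 1) != 0.
Proof.
move=> b10; have := red_det_neq0 b; rewrite red_detE b10 rmorph0 mulr0 subr0.
by rewrite mulf_eq0 negb_or => /andP[].
Qed.

Lemma bottom_row_borel (b : G) g : gl_mx b 1 0 = 0 ->
  bottom_row (b * g)%g =
    (red (gl_mx b 1 1) * (bottom_row g).1, red (gl_mx b 1 1) * (bottom_row g).2).
Proof.
by move=> b10; rewrite /bottom_row !gl_mulE b10 !mul0r !add0r !rmorphM.
Qed.

Lemma tangent_wedge_borel (b : G) g : gl_mx b 1 0 = 0 ->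
  tangent_wedge (b * g)%g = red (gl_mx b 1 1) ^+ 2 * tangent_wedge g.
Proof.
have [_ deltaM _] := delta_tangent.
move=> b10; rewrite /tangent_wedge !gl_mulE b10 !mul0r !add0r !rmorphM !deltaM.
ring.
Qed.

Lemma wedge_act h u w :
  wedge (row_act h u) (row_act h w) = red_det h * wedge u w.
Proof. by rewrite red_detE /wedge /row_act /=; ring. Qed.

Lemma row_act_inj h : injective (row_act h).
Proof.
move=> u w euw; have det0 := red_det_neq0 h.
have inj x : wedge u x = wedge w x.
  by apply: (mulfI det0); rewrite -!wedge_act euw.
have := inj (0, 1); have := inj (1, 0).
rewrite /wedge /= !mulr0 !mulr1 !sub0r !subr0 => /oppr_inj e2 e1.
by case: u w e1 e2 {euw inj} => [u1 u2] [w1 w2] /= -> ->.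
Qed.

Lemma gl_of_bottom_row (c d : A) : (red c, red d) != 0 :> k * k ->
  exists g, gl_mx g 1 0 = c /\ gl_mx g 1 1 = d.
Proof.
move=> cd0.
(* [(x, y)] is the first row of the matrix. *)
have mk (x y : A) : red (x * d - y * c) != 0 ->
    exists g, gl_mx g 1 0 = c /\ gl_mx g 1 1 = d.
  move=> xy0.
  pose M := \matrix_(i < 2, j < 2)
    (nth [::] [:: [:: x; y]; [:: c; d]] i)`_j.
  have uM : M \in unitmx.
    by rewrite unitmxE det_mx22 !mxE /=; exact: red_neq0_unit.
  by exists (GeneralLinear uM); rewrite !mxE.
have [d0|d0] := eqVneq (red d) 0; last first.
  by apply: (mk 1 0); rewrite mul1r mul0r subr0.
apply: (mk 0 (-1)); rewrite mul0r mulNr opprK add0r mul1r.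
by apply: contraNneq cd0 => c0; rewrite c0 d0.
Qed.

Lemma bottom_row_wedge_surj u (t : k) : u != 0 ->
  exists g, bottom_row g = u /\ tangent_wedge g = t.
Proof.
have [_ _ lift] := delta_tangent.
case: u => x y u0.
have mk s s' : x * s' - y * s = t ->
    exists g, bottom_row g = (x, y) /\ tangent_wedge g = t.
  have [c rc dc] := lift x s; have [d rd dd] := lift y s'.
  have [|g [g0 g1]] := @gl_of_bottom_row c d; first by rewrite rc rd.
  by exists g; rewrite /bottom_row /tangent_wedge g0 g1 rc rd dc dd.
have [y0|y0] := eqVneq y 0; last first.
  apply: (mk (- (t / y)) 0).
  by rewrite mulr0 sub0r mulrN opprK mulrCA mulfV ?mulr1.
apply: (mk 0 (t / x)); rewrite mulr0 subr0 mulrCA mulfV ?mulr1 //.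
by apply: contraNneq u0 => x0; rewrite x0 y0.
Qed.

(** Including the zero vector makes [plane] a full enumeration; it contributes
    nothing to [intertwiner m] when [m] is positive. *)
Definition plane : seq (k * k) := [seq (x, y) | x <- ks, y <- ks].

Definition intertwiner m (phi : k * k -> E) u : E :=
  \sum_(w <- plane) iota (wedge u w) ^+ m * phi w.

Lemma plane_uniq : uniq plane.
Proof. by apply: allpairs_uniq => // -[x y] [x' y'] _ _ [-> ->]. Qed.

Lemma mem_plane u : u \in plane.
Proof. by case: u => x y; apply: allpairs_f. Qed.

(** The summation variable is transported by [h], which rescales the wedge by
    its determinant. *)
Lemma intertwiner_act m phi h u :
  intertwiner m phi (row_act h u) =
  iota (red_det h) ^+ m * intertwiner m (phi \o row_act h) u.
Proof.
rewrite /intertwiner.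
rewrite -(perm_big _ (perm_map_enum plane_uniq mem_plane (@row_act_inj h))).
rewrite big_map mulr_sumr; apply: eq_bigr => w _.
by rewrite wedge_act rmorphM exprMn mulrA.
Qed.

Lemma intertwinerD m a phi psi u :
  intertwiner m (fun w => a * phi w + psi w) u =
  a * intertwiner m phi u + intertwiner m psi u.
Proof.
rewrite /intertwiner mulr_sumr -big_split; apply: eq_bigr => w _ /=.
by rewrite mulrDr mulrCA.
Qed.

Lemma intertwiner_scale m phi c u :
  intertwiner m phi (c * u.1, c * u.2) = iota c ^+ m * intertwiner m phi u.
Proof.
rewrite /intertwiner mulr_sumr; apply: eq_bigr => w _.
rewrite mulrA -exprMn -rmorphM; congr (iota _ ^+ _ * _).
by rewrite /wedge /=; ring.
Qed.

Variables (p n0 n1 r : nat).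
Hypotheses (p_prime : prime p) (p_eq0 : p%:R = 0 :> k).
Hypotheses (n0_gt0 : (0 < n0)%N) (n0_ltp : (n0 < p)%N) (n1_gt0 : (0 < n1)%N).
Hypothesis pn1_ltq : (p * n1 < q)%N.
Hypothesis expr_r : forall x : k, x != 0 -> x ^+ r = x ^+ (n0 + p * n1).

(** The exponent is [n0 - p * n1] modulo [q - 1], which makes the twist of
    [intertwiner_act] compatible with the determinants [det^n0] and
    [det^(p * n1)] that rescale the two top coefficients. *)
Local Notation m := (n0 + q.-1 - p * n1)%N.
Local Notation T := (intertwiner m).

Definition borel : set G := [set b : G | gl_mx b 1 0 = 0].

Definition borel_char (b : G) : E := iota (red (gl_mx b 1 1) ^+ r).

Local Notation V := (induced borel borel_char).

Definition wedge_polynomial (a b : k * k -> {poly E}) (g : G) : E :=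
  (a (bottom_row g)).[iota (tangent_wedge g)] +
  (b (bottom_row g)).[iota (tangent_wedge g) ^+ p].

Definition graph_coefs (lam : E) (a b : k * k -> {poly E}) : Prop :=
  [/\ forall u, (size (a u) <= n0.+1)%N,
      forall u, (size (b u) <= n1.+1)%N &
      forall u, (b u)`_n1 = lam * T (fun w => (a w)`_n0) u].

Definition graph_submodule (lam : E) : set (G -> E) :=
  [set Psi | V Psi /\
    exists a b, graph_coefs lam a b /\ Psi =1 wedge_polynomial a b].

Lemma m_gt0 : (0 < m)%N. Proof. by lia. Qed.

Lemma pchar_E : p \in [pchar E].
Proof. by rewrite inE p_prime -(rmorph_nat iota) p_eq0 rmorph0 eqxx. Qed.

(** The lower coefficients of [a] and [b] are unconstrained; the top ones are
    rescaled by [c ^+ n0] and [c ^+ (p * n1)], where [c] is the reduced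
    determinant of [h], in accordance with [intertwiner_act]. The substitution
    in [b] is affine because taking [p]-th powers is additive. *)
Lemma graph_coefs_translate lam a b h : graph_coefs lam a b ->
  exists a' b', graph_coefs lam a' b' /\
    forall g, wedge_polynomial a b (g * h)%g = wedge_polynomial a' b' g.
Proof.
move=> [sa sb ab]; pose c := iota (red_det h).
pose s u := iota (wedge_shift h u).
exists (fun u => a (row_act h u) \Po (c *: 'X + (s u)%:P)).
exists (fun u => b (row_act h u) \Po (c ^+ p *: 'X + (s u ^+ p)%:P)).
have c0 : c != 0 by rewrite fmorph_eq0 red_det_neq0.
split; last first.
  move=> g; rewrite /wedge_polynomial bottom_row_mul tangent_wedge_mul.
  rewrite rmorphD rmorphM !horner_comp !hornerD !hornerZ !hornerX !hornerC.
  by rewrite exprDn_pchar ?pnatE ?pchar_E // exprMn.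
split=> [u|u|u]; [exact: size_comp_affine|exact: size_comp_affine|].
rewrite coef_comp_affine // ab intertwiner_act /intertwiner !mulr_sumr.
apply: eq_bigr => w _; rewrite coef_comp_affine //=.
suff <- : (c ^+ p) ^+ n1 * c ^+ m = c ^+ n0 by rewrite -/c; ring.
rewrite -exprM -exprD subnKC; last by lia.
rewrite exprD -[c ^+ q.-1]rmorphXn enum_expf_pred ?rmorph1 ?mulr1 //.
exact: red_det_neq0.
Qed.

Lemma graph_submodule_closed lam : submodule V (graph_submodule lam).
Proof.
split.
- by move=> Psi [].
- split; first by move=> b g _; rewrite mulr0.
  exists (fun=> 0), (fun=> 0); split.
    split=> u; rewrite ?size_poly0 // coef0 /intertwiner big1 ?mulr0 // => w _.
    by rewrite coef0 mulr0.
  by move=> g; rewrite /wedge_polynomial !horner0 addr0.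
- move=> x phi psi [Vphi [a [b [[sa sb ab] phiE]]]].
  move=> [Vpsi [a' [b' [[sa' sb' ab'] psiE]]]].
  split; first by move=> b0 g B0; rewrite Vphi // Vpsi // mulrDr mulrCA.
  exists (fun u => x *: a u + a' u), (fun u => x *: b u + b' u).
  split; last first.
    move=> g; rewrite phiE psiE /wedge_polynomial !hornerD !hornerZ; ring.
  have size_comb n (P Q : {poly E}) :
      (size P <= n)%N -> (size Q <= n)%N -> (size (x *: P + Q)%R <= n)%N.
    move=> sP sQ; apply: leq_trans (size_polyD _ _) _.
    by rewrite geq_max sQ (leq_trans (size_scale_leq _ _)).
  split=> u; [exact: size_comb|exact: size_comb|].
  rewrite coefD coefZ ab ab' mulrCA -mulrDr -intertwinerD; congr (_ * _).
  by apply: eq_bigr => w _; rewrite coefD coefZ.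
- move=> h phi [Vphi [a [b [gab phiE]]]]; split.
    by move=> b0 g B0; rewrite /translate -mulgA (Vphi b0).
  have [a' [b' [gab' E']]] := graph_coefs_translate h gab.
  by exists a', b'; split=> // g; rewrite -E' /translate phiE.
Qed.

(** Supported on one line, and of the weight [r - 2 * n0] that the coefficient
    of the [n0]-th power of the wedge must have in an element of [V]. *)
Definition axis_fun (u : k * k) : E :=
  if u.1 == 0 then iota u.2 ^+ (p * n1 - n0) else 0.

Definition graph_fun (lam : E) : G -> E :=
  wedge_polynomial (fun u => axis_fun u *: 'X^n0)
                   (fun u => (lam * T axis_fun u) *: 'X^n1).

Lemma n0_lt_pn1 : (n0 < p * n1)%N.
Proof. by apply: leq_trans n0_ltp _; rewrite leq_pmulr. Qed.

Lemma axis_fun_scale c u : c != 0 ->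
  axis_fun (c * u.1, c * u.2) = iota c ^+ (p * n1 - n0) * axis_fun u.
Proof.
move=> c0; rewrite /axis_fun /= mulf_eq0 (negPf c0) /=.
by case: eqP => _; rewrite ?mulr0 // rmorphM exprMn.
Qed.

Lemma graph_fun_in lam : graph_submodule lam (graph_fun lam).
Proof.
split; last first.
  exists (fun u => axis_fun u *: 'X^n0).
  exists (fun u => (lam * T axis_fun u) *: 'X^n1).
  split=> //; split=> u.
  - by rewrite (leq_trans (size_scale_leq _ _)) // size_polyXn.
  - by rewrite (leq_trans (size_scale_leq _ _)) // size_polyXn.
  rewrite coefZ coefXn eqxx mulr1; congr (_ * _); apply: eq_bigr => w _.
  by rewrite coefZ coefXn eqxx mulr1.
move=> b g B0; rewrite /graph_fun /wedge_polynomial.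
rewrite bottom_row_borel // tangent_wedge_borel //.
have b0 := borel_entry B0; rewrite !hornerZ !hornerXn.
rewrite axis_fun_scale // intertwiner_scale /borel_char.
rewrite rmorphM rmorphXn expr_r //.
set c := red _; rewrite rmorphXn; set C := iota c; set D := iota _.
(* A row scaled by [c] has its wedge scaled by [c ^+ 2], so both terms of
   [graph_fun] have weight [n0 + p * n1]. *)
have E1 : C ^+ (p * n1 - n0) * (C ^+ 2) ^+ n0 = C ^+ (n0 + p * n1).
  rewrite -exprM -exprD; congr (_ ^+ _); have := n0_lt_pn1; lia.
have E2 : C ^+ m * (C ^+ 2) ^+ p ^+ n1 = C ^+ (n0 + p * n1).
  rewrite -!exprM -exprD (_ : (_ + _)%N = (n0 + p * n1 + q.-1)%N).
    by rewrite exprD -[C ^+ q.-1]rmorphXn enum_expf_pred // rmorph1 mulr1.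
  by move: pn1_ltq; lia.
by rewrite mulrDr -{1}E1 -E2 !exprMn; ring.
Qed.

(** On the support of [axis_fun], the kernel of the operator and the function
    multiply to [y ^+ q.-1], whose sum over [k] is -1. *)
Lemma intertwiner_axis_fun : T axis_fun (1, 0) = -1.
Proof.
rewrite /intertwiner /plane big_allpairs_dep (bigD1_seq 0) //=.
rewrite [X in _ + X]big1 ?addr0 => [|x x0]; last first.
  by rewrite big1 // => y _; rewrite /axis_fun /= (negPf x0) mulr0.
have q_gt1 : (1 < q)%N by have := n0_lt_pn1; lia.
rewrite -(rmorphN1 iota) -(sum_enum_expf_pred ks_uniq ks_all) // rmorph_sum.
apply: eq_bigr => y _; rewrite /axis_fun /= eqxx /wedge /= mul1r mul0r subr0.
rewrite rmorphXn -exprD; congr (_ ^+ _); have := n0_lt_pn1; lia.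
Qed.

(** For fixed [u] both sides are polynomials in [tangent_wedge g] of degree
    below [q] that agree at all [q] elements of [k], so they are equal. The
    exponents [n0] and [p * n1] do not interfere: [n0 < p] is not a multiple of
    [p], and [p * n1] exceeds the degree [n0] of the first part. *)
Lemma coefs_of_wedge_polynomial (P Q a b : k * k -> {poly E}) u :
  (forall w, (size (P w) <= n0.+1)%N) -> (forall w, (size (Q w) <= n1.+1)%N) ->
  (forall w, (size (a w) <= n0.+1)%N) -> (forall w, (size (b w) <= n1.+1)%N) ->
  wedge_polynomial P Q =1 wedge_polynomial a b -> u != 0 ->
  (P u)`_n0 = (a u)`_n0 /\ (Q u)`_n1 = (b u)`_n1.
Proof.
move=> sP sQ sa sb ePQ u0.
pose R := (P u - a u) + ((Q u - b u) \Po 'X^p).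
have sub_size n (S S' : {poly E}) :
    (size S <= n)%N -> (size S' <= n)%N -> (size (S - S')%R <= n)%N.
  move=> sS sS'; rewrite (leq_trans (size_polyD _ _)) //.
  by rewrite geq_max sS size_polyN.
have R0 : R = 0.
  apply: (@roots_geq_poly_eq0 _ _ (map iota ks)).
  - apply/allP => _ /mapP[t _ ->].
    have [g [gu gt]] := bottom_row_wedge_surj t u0.
    have := ePQ g; rewrite /wedge_polynomial gu gt => et.
    rewrite /root /R !hornerD horner_comp !hornerD !hornerN hornerXn.
    by rewrite addrACA et -opprD subrr.
  - by rewrite map_inj_uniq //; exact: fmorph_inj.
  rewrite size_map; apply: leq_trans (size_polyD _ _) _; rewrite geq_max.
  apply/andP; split.
    apply: leq_trans (sub_size _ _ _ (sP u) (sa u)) _.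
    exact: ltn_trans n0_lt_pn1 pn1_ltq.
  apply: leq_trans (size_comp_poly_leq _ _) _; rewrite size_polyXn /=.
  apply: leq_ltn_trans pn1_ltq; rewrite mulnC leq_mul2l.
  by apply/orP; right; have := sub_size _ _ _ (sQ u) (sb u); case: (size _).
have p0 : (0 < p)%N by lia.
split; apply/eqP; rewrite -subr_eq0 -coefB.
  have := congr1 (fun S : {poly E} => S`_n0) R0.
  rewrite /R coefD coef0 coef_comp_poly_Xn //.
  by rewrite gtnNdvd // addr0 => ->.
have := congr1 (fun S : {poly E} => S`_(p * n1)) R0.
rewrite /R coefD coef0 coef_comp_poly_Xn // dvdn_mulr // mulKn //.
rewrite nth_default ?add0r => [->//|].
by apply: leq_trans (sub_size _ _ _ (sP u) (sa u)) _; exact: n0_lt_pn1.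
Qed.

Lemma graph_submodule_inj : injective graph_submodule.
Proof.
move=> lam mu e; have := graph_fun_in lam.
rewrite e => -[_ [a [b [[sa sb ab] gE]]]].
have coefE u : u != 0 ->
    (axis_fun u *: 'X^n0)`_n0 = (a u)`_n0 /\
    ((lam * T axis_fun u) *: 'X^n1)`_n1 = (b u)`_n1.
  apply: (coefs_of_wedge_polynomial (P := fun u => axis_fun u *: 'X^n0)
    (Q := fun u => (lam * T axis_fun u) *: 'X^n1)) => // w;
  by rewrite (leq_trans (size_scale_leq _ _)) // size_polyXn.
(* At [w = 0] nothing is known about [a], but the kernel vanishes there. *)
have Ta : T (fun w => (a w)`_n0) (1, 0) = T axis_fun (1, 0).
  apply: eq_bigr => w _; have [->|w0] := eqVneq w 0.
    rewrite /wedge /= mulr0 mul0r subrr rmorph0 expr0n gtn_eqF ?m_gt0 //.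
    by rewrite !mul0r.
  by have [<- _] := coefE w w0; rewrite coefZ coefXn eqxx mulr1.
have [|_] := coefE (1, 0).
  by apply/eqP => -[/eqP]; rewrite oner_eq0.
rewrite ab Ta coefZ coefXn eqxx mulr1 intertwiner_axis_fun.
by rewrite !mulrN1 => /oppr_inj.
Qed.

Lemma infinite_submodules : infinite_set [set: E] ->
  infinite_set [set U | submodule V U].
Proof.
move=> infE finV; apply: infE.
have fin_im : finite_set (range graph_submodule).
  by apply: sub_finite_set finV => _ [lam _ <-]; exact: graph_submodule_closed.
have injS : {in setT &, injective graph_submodule} := in2W graph_submodule_inj.
by rewrite -(eq_finite_set (inj_card_eq injS)).
Qed.

End GraphSubmodules.

(** * Digits in base p and the infinite family *)

Lemma sum_digits_lt (p f : nat) (d : 'I_f -> 'I_p) :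
  (\sum_(i < f) d i * p ^ i < p ^ f)%N.
Proof.
elim: f d => [|f IHf] d; first by rewrite big_ord0 expn0.
rewrite big_ord_recr /= expnS.
apply: (@leq_trans (p ^ f + d ord_max * p ^ f)%N).
  by rewrite ltn_add2r; exact: (IHf (fun i => d (widen_ord (leqnSn f) i))).
by rewrite -mulSn leq_mul2r ltn_ord orbT.
Qed.

Theorem proposition4p23 (p : nat) (p_pr : prime p) (p_odd : odd p)
    (F : fieldExtType (padic p_pr)) (v : normalized_valuation F)
    (f : nat) (card_k : [set: residue_field v] #= `I_(p ^ f))
    (E : fieldType) (iota : {rmorphism residue_field v -> E})
    (e_ge2 : 2 <= ramification_index v) (f_ge2 : (2 <= f)%N)
    (r : 'Z_((p ^ f).-1)) (d : 'I_f -> 'I_p) (d_digits : is_digits r d)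
    (d_bounds : forall i, (1 <= d i <= p - 2)%N)
    (E_infinite : infinite_set [set: E]) :
  infinite_set [set U | submodule (V2 iota r) U].
Proof.
have [ks [ks_uniq ks_all size_ks]] := card_eq_enum card_k.
have f_gt0 : (0 < f)%N by apply: ltnW.
have [delta delta_tangent] :=
  trunc_ring_derivation e_ge2 f_gt0 ks_uniq ks_all size_ks.
case: f f_ge2 {card_k f_gt0} r d size_ks d_digits d_bounds => [|[|f]] // _.
move=> r d size_ks digits bounds.
pose n0 : nat := d ord0.
pose n1 := (\sum_(i < f.+1) d (lift ord0 i) * p ^ i)%N.
have sumE : (\sum_(i < f.+2) d i * p ^ i = n0 + p * n1)%N.
  rewrite big_ord_recl expn0 muln1 big_distrr; congr addn.
  by apply: eq_bigr => i _; rewrite /= expnS mulnCA.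
have n1_gt0 : (0 < n1)%N.
  rewrite /n1 big_ord_recl expn0 muln1 addn_gt0.
  by case/andP: (bounds (lift ord0 ord0)) => ->.
have n0_gt0 : (0 < n0)%N by case/andP: (bounds ord0).
have pn1_lt : (p * n1 < size ks)%N.
  rewrite size_ks; apply: leq_ltn_trans (sum_digits_lt d).
  by rewrite sumE leq_addl.
have p_eq0 : p%:R = 0 :> residue_field v.
  have [pi pi0 v_pi] := exists_uniformizer v.
  rewrite -(rmorph_nat (@reduce p p_pr F v)) (trunc_ring_pchar pi0 v_pi e_ge2).
  exact: rmorph0.
apply: (@infinite_submodules _ _ _ delta delta_tangent (@reduce_neq0_unit _ _ _ v)
  E iota ks ks_uniq ks_all p n0 n1 r) => //; first exact: ltn_ord.
move=> x x0.
(* When [r] is 0 the digits represent [q - 1], and [x ^+ (q - 1) = x ^+ 0]. *)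
rewrite -sumE digits /pos_repr; case: eqP => // ->.
by rewrite -size_ks (enum_expf_pred ks_uniq ks_all).
Qed.
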